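(* For each fixed $y\in[0,1]$ and each fixed $q>1$, the function $p\mapsto\sin_{p,q}(y)$ is concave on $(1,\infty)$. For each fixed $y\in[0,1]$ and each fixed $p>1$, the function $q\mapsto\sin_{p,q}(y)$ is concave on $(1,\infty)$.
   Context: For $p,q>1$, $\arcsin_{p,q}(x)=\int_0^x (1-t^q)^{-1/p}\,dt$ for $x\in[0,1]$, $\pi_{p,q}/2=\arcsin_{p,q}(1)$, and $\sin_{p,q}:[0,\pi_{p,q}/2]\to[0,1]$ is the inverse of $\arcsin_{p,q}$. One has $[0,1]=\bigcap_{p>1}[0,\pi_{p,q}/2]$ for each $q>1$ and $[0,1]=\bigcap_{q>1}[0,\pi_{p,q}/2]$ for each $p>1$, so $\sin_{p,q}(y)$ is defined for all $p,q>1$ when $y\in[0,1]$. *)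

(* Defs.v *)
From HB Require Import structures.
From mathcomp Require Import all_boot all_order all_algebra.
From mathcomp Require Import all_classical all_reals all_analysis.

Set Implicit Arguments.
Unset Strict Implicit.
Unset Printing Implicit Defensive.

Import Order.TTheory GRing.Theory Num.Theory.
Import numFieldNormedType.Exports.

Local Open Scope classical_set_scope.
Local Open Scope ring_scope.
Local Open Scope convex_scope.

(* As [powR 0 r = 0] for r != 0, the integrand is 0 rather than +oo at t = 1;
   this is a null set. Meaningful for 0 <= x <= 1 only. *)
Definition arcsin_pq (R : realType) (p q x : R) : R :=
  \int[lebesgue_measure]_(t in `[0, x]) (1 - t `^ q) `^ (- p^-1).

(* Inverse of [arcsin_pq p q] restricted to [0, 1], in the style of [asin].
   Meaningful for y in the image [0, arcsin_pq p q 1], which contains [0, 1]. *)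
Definition sin_pq (R : realType) (p q y : R) : R :=
  get [set x | 0 <= x <= 1 /\ arcsin_pq p q x = y].

(* [convex_function] with the inequality reversed. *)
Definition concave_function (R : numFieldType) (E : lmodType R)
    (E' := convex_lmodType E) (D : set E') (f : E' -> R^o) :=
  forall t : {i01 R},
    {in D &, forall x y : E', f x <| t |> f y <= f (x <| t |> y)}.

(* Main.v *)
Require Import Defs.
From HB Require Import structures.
From mathcomp Require Import all_boot all_order all_algebra.
From mathcomp Require Import all_classical all_reals all_analysis.
From mathcomp Require Import measurable_realfun ring lra.
Import Order.TTheory GRing.Theory Num.Theory.
Import numFieldNormedType.Exports.
Local Open Scope classical_set_scope.
Local Open Scope ring_scope.

(** Write [k_(p,q)(t) = (1 - t^q)^(-1/p)] for the integrand, [A_(p,q)] for its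
    integral from 0, and [S_(p,q)] for the inverse of [A_(p,q)]. The integrand
    is dominated by [(1 - t)^(-1/p)], so it is integrable on [[0, 1]] because
    [p > 1], and it exceeds 1 on the open interval, so [A_(p,q) 1 > 1]. Hence
    [S_(p,q)] is defined on [[0, 1]], has values in [[0, 1[], and solves
    [S' = 1 / k(S)], [S 0 = 0]. Since [A] increases, a bound [x <= S y] is the
    same as [A x <= y]; in both halves [x] is a convex combination of two
    values [x1], [x2] of [S y], and [A x] is bounded by transporting the paths
    leading to [x1] and [x2] onto a path leading to [x].

    Concavity in [p]. Transport by scaling: substituting [t = x s] gives
    [A_(p,q) x = \int_0^1 x k_(p,q)(x s) ds], so it is enough that
    [z k_(p,q)(z)] is jointly convex in [(z, p)]
    ([mul_powR_integrand_convex]). With [a z = - ln (1 - z^q)] this function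
    is [z exp(a z / p)], the supremum over [c] of
    [exp(c) (z (1 - c) + z a z / p)], so the claim reduces to the joint
    convexity of [z a z / p] ([mul_ln_div_convex]). The logarithmic series
    expands it into terms [z^(1 + q k) / (k p)], [k >= 1], each of which is the
    square of a convex nonnegative function of [z] divided by [k p], as
    [1 + q k >= 2].

    Concavity in [q]. Scaling fails here, and the paths are instead
    synchronised by the value of the integral: with [S1], [S2], [S] the
    solutions for [q1 <= q2] and [q = l q1 + m q2], and [W = l S1 + m S2], the
    derivative of [A_(p,q)(W y)] is [k_(p,q)(W) (l / k1(S1) + m / k2(S2))]. It
    is at most 1, whence [A_(p,q)(W y) <= y], as soon as [1 / k] is concave on
    the segment from [(q1, S1)] to [(q2, S2)]. Now [1 / k = (1 - t^q)^(1/p)] is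
    not jointly concave in [(q, t)], but it is along segments on which [t] is a
    nondecreasing and [t / q] a nonincreasing function of [q], for [q ln t] is
    convex there ([powR_segment_convex], [integrand_inv_segment_concave]); and
    comparison of integrands shows that [S] is nondecreasing in [q]
    ([sin_pq_nondecreasing_q]) while [S / q] is nonincreasing
    ([sin_pq_div_nonincreasing_q]). *)

Set Implicit Arguments.
Unset Strict Implicit.
Unset Printing Implicit Defensive.

(** * Convexity inequalities for the integrand *)

Definition integrand {R : realType} (p q t : R) : R := (1 - t `^ q) `^ (- p^-1).

Section inequalities.
Variable R : realType.
Implicit Types (l m p q t z w c u : R).

Lemma powR_lt1 c z : 0 < c -> 0 <= z -> z < 1 -> z `^ c < 1.
Proof.
move=> c0 z0 z1; have := @gt0_ltr_powR _ c c0 z 1.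
by rewrite powR1; apply; rewrite ?nnegrE.
Qed.

Lemma comb_gt c l m z1 z2 : 0 <= l -> 0 <= m -> l + m = 1 ->
  c < z1 -> c < z2 -> c < l * z1 + m * z2.
Proof.
move=> l0 m0 lm cz1 cz2.
have -> : c = l * c + m * c by rewrite -mulrDl lm mul1r.
move: l0; rewrite le_eqVlt => /predU1P[l0|l0].
  have -> : m = 1 by rewrite -lm -l0 add0r.
  by rewrite -l0 !mul0r !add0r !mul1r.
by rewrite ltr_leD ?ltr_pM2l// ler_wpM2l// ltW.
Qed.

Lemma comb_lt c l m z1 z2 : 0 <= l -> 0 <= m -> l + m = 1 ->
  z1 < c -> z2 < c -> l * z1 + m * z2 < c.
Proof.
move=> l0 m0 lm z1c z2c; rewrite -ltrN2 opprD -!mulrN.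
by apply: comb_gt => //; rewrite ltrN2.
Qed.

Lemma powR_convex_comb c l m z1 z2 : 1 <= c -> 0 <= l -> 0 <= m -> l + m = 1 ->
  0 <= z1 -> 0 <= z2 ->
  (l * z1 + m * z2) `^ c <= l * z1 `^ c + m * z2 `^ c.
Proof.
move=> c1 l0 m0 lm z10 z20; have l1 : l <= 1 by lra.
have -> : m = 1 - l by lra.
have := @convex_powR R c c1 (Itv01 l0 l1) z1 z2.
by rewrite !convRE/=; apply; rewrite inE/= in_itv/= andbT.
Qed.

(** [z^c / p] is the perspective [v^2 / p] of the square at [v = z^(c/2)], and
    [v] is convex in [z] because [c / 2 >= 1]; the perspective is convex by the
    Cauchy-Schwarz inequality, seen below as an explicit square. *)
Lemma powR_div_convex c l m z1 z2 p1 p2 : 2 <= c ->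
  0 <= l -> 0 <= m -> l + m = 1 ->
  0 <= z1 -> 0 <= z2 -> 0 < p1 -> 0 < p2 ->
  (l * z1 + m * z2) `^ c / (l * p1 + m * p2) <=
  l * (z1 `^ c / p1) + m * (z2 `^ c / p2).
Proof.
move=> c2 l0 m0 lm z10 z20 p10 p20.
have sq z : 0 <= z -> z `^ c = (z `^ (c / 2)) ^+ 2.
  by move=> z0; rewrite -powR_mulrn ?powR_ge0// -powRrM divfK.
have hc : 1 <= c / 2 by lra.
have := @powR_convex_comb (c / 2) l m z1 z2 hc l0 m0 lm z10 z20.
have zl0 : 0 <= l * z1 + m * z2 by rewrite addr_ge0// mulr_ge0.
rewrite !sq//.
move: (powR_ge0 (l * z1 + m * z2) (c / 2)).
move: ((l * z1 + m * z2) `^ (c / 2)) (z1 `^ (c / 2)) (z2 `^ (c / 2)) => v v1 v2.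
move=> v0 vle.
have P0 : 0 < l * p1 + m * p2. exact: comb_gt.
rewrite ler_pdivrMr//.
apply: (@le_trans _ _ ((l * v1 + m * v2) ^+ 2)).
  by rewrite ler_pXn2r// nnegrE// (le_trans v0).
rewrite -subr_ge0.
have -> : (l * (v1 ^+ 2 / p1) + m * (v2 ^+ 2 / p2)) * (l * p1 + m * p2)
    - (l * v1 + m * v2) ^+ 2 = l * m * ((v1 * p2 - v2 * p1) ^+ 2 / (p1 * p2)).
  by field; rewrite !gt_eqF.
apply: mulr_ge0; first exact: mulr_ge0.
by apply: divr_ge0; [exact: sqr_ge0|exact/ltW/mulr_gt0].
Qed.

(** The derivative of [- ln (1 - w)] is the geometric series [1 / (1 - w)], and
    removing the first [n] terms of the logarithmic series removes the first
    [n] terms of the geometric one. *)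
Lemma is_derive_ln_series_remainder (n : nat) w : w < 1 ->
  is_derive w 1 (fun x : R => - ln (1 - x) - \sum_(k < n) x ^+ k.+1 / k.+1%:R)
    (w ^+ n / (1 - w)).
Proof.
move=> w1; elim: n => [|n IH].
  have dl : is_derive w 1 (fun x : R => ln (1 - x)) ((1 - w)^-1 * (0 - 1)).
    have d1 := is_derive1_ln (etrans (subr_gt0 w 1) w1).
    have d2 : is_derive w 1 (fun x : R => 1 - x) (0 - 1) by exact: is_deriveB.
    exact: (@is_derive1_comp R (@ln R) (fun x => 1 - x) w _ _ d1 d2).
  have -> : (fun x : R => - ln (1 - x) - \sum_(k < 0) x ^+ k.+1 / k.+1%:R) =
      (fun x : R => - ln (1 - x)).
    by apply/funext => x; rewrite big_ord0 subr0.
  apply: (is_derive_eq (is_deriveN dl)).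
  by rewrite expr0; ring.
have -> : (fun x : R => - ln (1 - x) - \sum_(k < n.+1) x ^+ k.+1 / k.+1%:R) =
    (fun x : R => - ln (1 - x) - \sum_(k < n) x ^+ k.+1 / k.+1%:R)
    - (n.+1%:R^-1 \*: (@GRing.exp R ^~ n.+1)).
  apply/funext => x; rewrite big_ord_recr/=.
  by rewrite -[RHS]/(_ - _ * _); ring.
have dX : is_derive w 1 (@GRing.exp R ^~ n.+1) (n.+1%:R * w ^+ n).
  have := @is_deriveX R R id n.+1 w 1 1 (is_derive_id _ _).
  have -> : (id : R -> R) ^+ n.+1 = (@GRing.exp R ^~ n.+1).
    by apply/funext => x; rewrite exprfctE.
  by move=> h; apply: (is_derive_eq h); rewrite /GRing.scale/= mulr1.
apply: (is_derive_eq (is_deriveB IH (is_deriveZ _ dX))).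
rewrite /GRing.scale/= mulKf ?pnatr_eq0// exprS; field.
by rewrite subr_eq0 gt_eqF.
Qed.

Lemma ln_series_remainder (n : nat) w : 0 <= w < 1 ->
  0 <= - ln (1 - w) - \sum_(k < n) w ^+ k.+1 / k.+1%:R <= w ^+ n / (1 - w).
Proof.
move=> /andP[w0 w1].
pose f (x : R) : R := - ln (1 - x) - \sum_(k < n) x ^+ k.+1 / k.+1%:R.
pose df (x : R) : R := x ^+ n / (1 - x).
have fd (x : R) : x < 1 -> is_derive x 1 f (df x).
  exact: is_derive_ln_series_remainder.
have [||c] := @MVT_segment R f df 0 w w0.
- by move=> x /[!in_itv]/= /andP[_ xw]; apply: fd; exact: lt_trans w1.
- apply: derivable_within_continuous => x /[!in_itv]/= /andP[_ xw].
  by apply: (@ex_derive _ _ _ _ _ _ (df x)); apply: fd; exact: le_lt_trans w1.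
rewrite in_itv/= => /andP[c0 cw].
have -> : f 0 = 0.
  rewrite /f subr0 ln1 oppr0 add0r big1 ?oppr0// => k _.
  by rewrite exprS !mul0r.
rewrite !subr0 -/(f w) => ->.
have c1 : 0 < 1 - c by rewrite subr_gt0 (le_lt_trans cw).
have dc0 : 0 <= df c by rewrite divr_ge0 ?exprn_ge0// ltW.
rewrite mulr_ge0//= -[leRHS]mulr1; apply: ler_pM => //; last exact/ltW.
apply: ler_pM; rewrite ?exprn_ge0 ?invr_ge0 ?(ltW c1)//.
  by rewrite lerXn2r ?nnegrE.
by rewrite lef_pV2 ?posrE// ?subr_gt0// lerD2l lerN2.
Qed.

Lemma cvg_ln_series w : 0 <= w < 1 ->
  (\sum_(k < n) w ^+ k.+1 / k.+1%:R) @[n --> \oo] --> - ln (1 - w).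
Proof.
move=> w01; have /andP[w0 w1] := w01.
pose r (n : nat) : R := - ln (1 - w) - \sum_(k < n) w ^+ k.+1 / k.+1%:R.
have r0 : r n @[n --> \oo] --> (0 : R).
  apply: (@squeeze_cvgr _ _ _ _ (fun=> 0) (fun n => w ^+ n / (1 - w))).
  - by apply: nearW => n; exact: ln_series_remainder.
  - exact: cvg_cst.
  - rewrite -(mul0r (1 - w)^-1); apply: cvgMl.
    by apply: cvg_expr; rewrite ger0_norm.
rewrite -[X in _ --> X]subr0.
have -> : (fun n => \sum_(k < n) w ^+ k.+1 / k.+1%:R) =
    (fun n => - ln (1 - w) - r n).
  by apply/funext => n; rewrite /r subKr.
by apply: cvgB => //; exact: cvg_cst.
Qed.

(** By the logarithmic series the left-hand side is a sum of terms
    [z^(1 + q k) / (k p)] with [k >= 1]. As [q >= 1], every exponent is at least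
    2, so that [powR_div_convex] applies term by term; partial sums bound the
    right-hand side from below and converge on the left-hand side. *)
Lemma mul_ln_div_convex q l m z1 z2 p1 p2 : 1 <= q ->
  0 <= l -> 0 <= m -> l + m = 1 ->
  0 <= z1 < 1 -> 0 <= z2 < 1 -> 0 < p1 -> 0 < p2 ->
  (l * z1 + m * z2) * - ln (1 - (l * z1 + m * z2) `^ q) / (l * p1 + m * p2) <=
  l * (z1 * - ln (1 - z1 `^ q) / p1) + m * (z2 * - ln (1 - z2 `^ q) / p2).
Proof.
move=> q1 l0 m0 lm /andP[z10 z11] /andP[z20 z21] p10 p20.
pose a (x : R) : R := - ln (1 - x `^ q).
rewrite -!/(a _).
set z := l * z1 + m * z2; set p := l * p1 + m * p2.
have z0 : 0 <= z by rewrite addr_ge0// mulr_ge0.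
have z1' : z < 1 by exact: comb_lt.
have p0 : 0 < p by exact: comb_gt.
have pow01 (x : R) : 0 <= x -> x < 1 -> 0 <= x `^ q < 1.
  move=> x0 x1; rewrite powR_ge0/= powR_lt1//.
  exact: lt_le_trans q1.
pose s (n : nat) (x : R) : R := \sum_(k < n) (x `^ q) ^+ k.+1 / k.+1%:R.
have sa n (x : R) : 0 <= x -> x < 1 -> s n x <= a x.
  move=> x0 x1; rewrite -subr_ge0.
  by have /andP[] := @ln_series_remainder n _ (pow01 _ x0 x1).
have sz n (x y : R) : 0 <= x ->
    x * s n x / y = \sum_(k < n) (x `^ (1 + q * k.+1%:R) / y) / k.+1%:R.
  move=> x0; rewrite /s mulr_sumr mulr_suml; apply: eq_bigr => k _.
  rewrite -powR_mulrn ?powR_ge0// -powRrM powRD; last first.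
    apply/implyP; rewrite gt_eqF// ltr_wpDr// mulr_ge0// (le_trans _ q1)//.
  by rewrite powRr1//; ring.
have lsz n : z * s n z / p <= l * (z1 * a z1 / p1) + m * (z2 * a z2 / p2).
  apply: (@le_trans _ _ (l * (z1 * s n z1 / p1) + m * (z2 * s n z2 / p2))).
    rewrite !sz// !mulr_sumr -big_split/=; apply: ler_sum => k _.
    rewrite [X in _ <= X](_ : _ = (l * (z1 `^ (1 + q * k.+1%:R) / p1) +
      m * (z2 `^ (1 + q * k.+1%:R) / p2)) / k.+1%:R); last by ring.
    rewrite ler_pM2r ?invr_gt0//; apply: powR_div_convex => //.
    have : (1 : R) <= k.+1%:R by rewrite ler1n.
    by move: k.+1%:R => k' k1; nra.
  by rewrite lerD// ler_wpM2l// ler_pM2r ?invr_gt0// ler_wpM2l// sa.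
have cv : (z * s n z / p) @[n --> \oo] --> z * a z / p.
  by apply: cvgMl; apply: cvgMr; apply: cvg_ln_series; exact: pow01.
rewrite -(cvg_lim (@Rhausdorff R) cv); apply: limr_le.
  by apply/cvg_ex; exists (z * a z / p).
by apply: nearW => n.
Qed.

(** The function is [z exp(a(z) / p)] with [a(z) = - ln (1 - z^q)]. Replacing the
    exponential by its tangent at the exponent [c] of the middle point gives a
    minorant, exact at the middle point, that is jointly convex by
    [mul_ln_div_convex] because [exp c] and [z] are nonnegative. *)
Lemma mul_powR_integrand_convex q l m z1 z2 p1 p2 : 1 <= q ->
  0 <= l -> 0 <= m -> l + m = 1 ->
  0 <= z1 < 1 -> 0 <= z2 < 1 -> 0 < p1 -> 0 < p2 ->
  (l * z1 + m * z2) * integrand (l * p1 + m * p2) q (l * z1 + m * z2) <=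
  l * (z1 * integrand p1 q z1) + m * (z2 * integrand p2 q z2).
Proof.
move=> q1 l0 m0 lm z1P z2P p10 p20.
pose k (r x : R) : R := integrand r q x.
rewrite -!/(k _ _).
have := mul_ln_div_convex q1 l0 m0 lm z1P z2P p10 p20.
move: z1P z2P => /andP[z10 z11] /andP[z20 z21].
set z := l * z1 + m * z2; set p := l * p1 + m * p2 => H.
have z0 : 0 <= z by rewrite addr_ge0// mulr_ge0.
have z1' : z < 1 by exact: comb_lt.
have kE (r x : R) : 0 <= x -> x < 1 -> k r x = expR (- ln (1 - x `^ q) / r).
  move=> x0 x1; rewrite /k /integrand /powR subr_eq0 gt_eqF; last first.
    by apply: powR_lt1 => //; exact: lt_le_trans q1.
  by congr expR; ring.
rewrite (kE p z)//.
set c := - ln (1 - z `^ q) / p in H *.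
(* The tangent of the exponential at [c], multiplied by [x]. *)
have tangent (r x : R) : 0 <= x -> x < 1 ->
    expR c * (x * (1 - c) + x * - ln (1 - x `^ q) / r) <= x * k r x.
  move=> x0 x1; rewrite kE//; set y := - ln (1 - x `^ q) / r.
  have -> : x * (1 - c) + x * - ln (1 - x `^ q) / r = x * (1 + (y - c)).
    by rewrite /y; ring.
  rewrite mulrCA ler_wpM2l// -[y in leRHS](subrK c) [y - c + c]addrC expRD.
  by rewrite ler_wpM2l ?expR_ge0// expR_ge1Dx.
have t1 := tangent p1 z1 z10 z11.
have t2 := tangent p2 z2 z20 z21.
apply: (@le_trans _ _
  (l * (expR c * (z1 * (1 - c) + z1 * - ln (1 - z1 `^ q) / p1)) +
   m * (expR c * (z2 * (1 - c) + z2 * - ln (1 - z2 `^ q) / p2)))); last first.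
  exact: (lerD (ler_wpM2l l0 t1) (ler_wpM2l m0 t2)).
rewrite [X in _ <= X](_ : _ = expR c * (z * (1 - c) +
   (l * (z1 * - ln (1 - z1 `^ q) / p1) +
    m * (z2 * - ln (1 - z2 `^ q) / p2)))); last first.
  by rewrite /z; ring.
rewrite mulrC ler_wpM2l ?expR_ge0//.
by rewrite mulrBr mulr1 -addrA lerDl addrC subr_ge0 -mulrA in H *.
Qed.

(** Bernoulli's inequality with a real exponent: by concavity of the logarithm,
    [ln (1 + c (w - 1)) <= c ln w], since [w] is the barycentre of
    [1 + c (w - 1)] and 1 with weights [1/c] and [1 - 1/c]. *)
Lemma powR_ge1D c w : 1 <= c -> 0 < w -> 1 + c * (w - 1) <= w `^ c.
Proof.
move=> c1 w0; have c0 : 0 < c by exact: lt_le_trans c1.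
have [s0|s0] := leP (1 + c * (w - 1)) 0.
  exact: le_trans s0 (powR_ge0 _ _).
rewrite /powR gt_eqF// -[leLHS]lnK ?posrE// ler_expR.
have ic0 : 0 <= c^-1 by rewrite invr_ge0 ltW.
have ic1 : c^-1 <= 1 by rewrite invf_le1.
have := @concave_ln R (Itv01 ic0 ic1) _ 1 s0 ltr01.
rewrite !convRE/= ln1 mulr0 addr0 mulr1.
move=> h.
rewrite -ler_pdivrMl//; apply: (le_trans h).
rewrite [X in ln X](_ : _ = w)//.
transitivity (c^-1 * (1 + c * (w - 1)) + (1 - c^-1)) => //.
by field; rewrite gt_eqF.
Qed.

(** The map [(q, t) |-> t^q] is not jointly convex; what holds is log-convexity
    along segments on which [t] increases and [t / q] decreases with [q].
    Indeed [q ln t >= q ln t0 + q (1 - t0 / t)] for the middle value [t0], and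
    the average of [q (1 - t0 / t)] over the endpoints is nonnegative by
    Chebyshev's sum inequality, as [t] and [q / t] are ordered alike. *)
Lemma powR_segment_convex l m q1 q2 t1 t2 :
  0 <= l -> 0 <= m -> l + m = 1 ->
  0 < q1 -> q1 <= q2 -> 0 < t1 -> t1 <= t2 -> t2 * q1 <= t1 * q2 ->
  (l * t1 + m * t2) `^ (l * q1 + m * q2) <= l * t1 `^ q1 + m * t2 `^ q2.
Proof.
move=> l0 m0 lm q10 q12 t10 t12 tq.
have q20 : 0 < q2 by exact: lt_le_trans q12.
have t20 : 0 < t2 by exact: lt_le_trans t12.
set t := l * t1 + m * t2; set q := l * q1 + m * q2.
have t0 : 0 < t by exact: comb_gt.
have lnge s : 0 < s -> ln t + (1 - t / s) <= ln s.
  move=> s0; rewrite -lerBrDl -lerN2 !opprB -ln_div ?posrE//.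
  have := @le_ln1Dx R (t / s - 1); rewrite [1 + _]addrC subrK; apply.
  by rewrite ltrBrDl subrr divr_gt0.
have key : t * (l * (q1 / t1) + m * (q2 / t2)) <= q.
  rewrite -subr_ge0.
  have -> : q - t * (l * (q1 / t1) + m * (q2 / t2)) =
      l * m * ((t2 - t1) * (t1 * q2 - t2 * q1) / (t1 * t2)).
    have -> : m = 1 - l by rewrite -lm addrC addKr.
    rewrite /q /t; have -> : m = 1 - l by rewrite -lm addrC addKr.
    by field; rewrite !gt_eqF.
  apply: mulr_ge0; first exact: mulr_ge0.
  by apply: divr_ge0; [apply: mulr_ge0; rewrite subr_ge0|exact/ltW/mulr_gt0].
have le_exp : q * ln t <= l * (q1 * ln t1) + m * (q2 * ln t2).
  apply: (@le_trans _ _ (l * (q1 * (ln t + (1 - t / t1))) +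
                         m * (q2 * (ln t + (1 - t / t2))))).
    rewrite -subr_ge0 [X in 0 <= X](_ : _ =
      q - t * (l * (q1 / t1) + m * (q2 / t2))) ?subr_ge0//.
    by rewrite /q; ring.
  have h1 := lnge _ t10; have h2 := lnge _ t20.
  by apply: lerD; apply: ler_wpM2l => //; apply: ler_wpM2l => //; exact: ltW.
rewrite /powR !gt_eqF//.
apply: (@le_trans _ _ (expR (l * (q1 * ln t1) + m * (q2 * ln t2)))).
  by rewrite ler_expR.
have l1 : l <= 1 by rewrite -lm lerDl.
have := @convex_expR R (Itv01 l0 l1) (q1 * ln t1) (q2 * ln t2).
have -> : m = 1 - l by rewrite -lm addrC addKr.
by rewrite !convRE.
Qed.

Lemma integrandE p q t : integrand p q t = ((1 - t `^ q) `^ p^-1)^-1.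
Proof. exact: powRN. Qed.

Lemma integrand_inv p q t : (integrand p q t)^-1 = (1 - t `^ q) `^ p^-1.
Proof. by rewrite /integrand powRN invrK. Qed.

(** [1 - t^q] is concave along the segment by [powR_segment_convex], and the
    power [1/p <= 1] is concave and nondecreasing; its concavity is read off
    from the convexity of the inverse power [p]. *)
Lemma integrand_inv_segment_concave p l m q1 q2 t1 t2 : 1 < p ->
  0 <= l -> 0 <= m -> l + m = 1 ->
  0 < q1 -> q1 <= q2 -> 0 < t1 -> t1 <= t2 -> t2 < 1 -> t2 * q1 <= t1 * q2 ->
  l * (integrand p q1 t1)^-1 + m * (integrand p q2 t2)^-1 <=
  (integrand p (l * q1 + m * q2) (l * t1 + m * t2))^-1.
Proof.
move=> p1 l0 m0 lm q10 q12 t10 t12 t21 tq.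
have q20 : 0 < q2 by exact: lt_le_trans q12.
have t20 : 0 < t2 by exact: lt_le_trans t12.
rewrite [leLHS](_ : _ = l * (1 - t1 `^ q1) `^ p^-1 + m * (1 - t2 `^ q2) `^ p^-1);
  last by congr (_ + _); congr (_ * _); exact: integrand_inv.
rewrite [leRHS]integrand_inv.
have := powR_segment_convex l0 m0 lm q10 q12 t10 t12 tq.
have w1 : 0 <= 1 - t1 `^ q1.
  by rewrite subr_ge0 ltW// powR_lt1 ?(ltW t10)// (le_lt_trans t12).
have w2 : 0 <= 1 - t2 `^ q2.
  by rewrite subr_ge0 ltW// powR_lt1 ?(ltW t20).
move: (_ `^ (l * q1 + m * q2)) => w wle.
have p0 : 0 < p by exact: lt_trans p1.
have root x : 0 <= x -> x = (x `^ p^-1) `^ p.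
  by move=> x0; rewrite -powRrM mulVf ?gt_eqF// powRr1.
have cw : l * (1 - t1 `^ q1) + m * (1 - t2 `^ q2) <= 1 - w.
  by rewrite -[X in X - w]lm; lra.
move: w1 w2 cw; move: (1 - t1 `^ q1) (1 - t2 `^ q2) (1 - w) => v1 v2 v v10 v20 cw.
have := powR_convex_comb (ltW p1) l0 m0 lm (powR_ge0 v1 p^-1) (powR_ge0 v2 p^-1).
rewrite -!root// => h.
have := @ge0_ler_powR R p^-1 _ _ _ _ _ (le_trans h cw).
rewrite -powRrM divff ?gt_eqF// powRr1; last first.
  by rewrite addr_ge0// mulr_ge0// powR_ge0.
apply; rewrite ?nnegrE ?invr_ge0 ?powR_ge0 ?(ltW p0)//.
by rewrite (le_trans _ cw)// addr_ge0// mulr_ge0.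
Qed.

Lemma integrand_gt0 p q t : 0 < q -> 0 <= t < 1 -> 0 < integrand p q t.
Proof.
by move=> q0 /andP[t0 t1]; rewrite powR_gt0// subr_gt0 powR_lt1.
Qed.

Lemma integrand_le_exponent p q1 q2 t :
  0 < p -> 0 < q1 -> q1 <= q2 -> 0 < t < 1 ->
  integrand p q2 t <= integrand p q1 t.
Proof.
move=> p0 q10 q12 /andP[t0 t1]; have q20 : 0 < q2 by exact: lt_le_trans q12.
have w1 : 0 < 1 - t `^ q1 by rewrite subr_gt0 powR_lt1// ltW.
have w2 : 0 < 1 - t `^ q2 by rewrite subr_gt0 powR_lt1// ltW.
rewrite [leLHS]integrandE [leRHS]integrandE lef_pV2 ?posrE ?powR_gt0//.
apply: ge0_ler_powR; rewrite ?nnegrE ?invr_ge0 ?(ltW p0) ?(ltW w1) ?(ltW w2)//.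
by rewrite lerD2l lerN2 ger_powR// t0 ltW.
Qed.

(** With [w = t^q], Bernoulli's inequality gives
    [1 - (c t)^(c q) <= 1 - w^c <= c (1 - w)], and [c^(1/p) <= c]. This pointwise
    comparison makes [S_(p,q) / q] nonincreasing in [q]. *)
Lemma integrand_scale_exponent p q c t : 1 <= p -> 0 < q -> 1 <= c ->
  0 < t -> c * t < 1 ->
  integrand p q t <= c * integrand p (c * q) (c * t).
Proof.
move=> p1 q0 c1 t0 ct1.
have p0 : 0 < p by exact: lt_le_trans p1.
have c0 : 0 < c by exact: lt_le_trans c1.
have tct : t <= c * t by rewrite ler_peMl// ltW.
have t1 : t < 1 by exact: le_lt_trans ct1.
have cq0 : 0 < c * q by exact: mulr_gt0.
have w1 : 0 < 1 - t `^ q by rewrite subr_gt0 powR_lt1// ltW.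
have w2 : 0 < 1 - (c * t) `^ (c * q).
  by rewrite subr_gt0 powR_lt1// ltW// mulr_gt0.
have cw : 1 - (c * t) `^ (c * q) <= c * (1 - t `^ q).
  have : (t `^ q) `^ c <= (c * t) `^ (c * q).
    rewrite -powRrM [q * c]mulrC.
    by apply: ge0_ler_powR => //; rewrite ?nnegrE ltW// mulr_gt0.
  have := powR_ge1D c1 (powR_gt0 q t0); lra.
rewrite [leLHS]integrandE [integrand p (c * q) _]integrandE.
rewrite ler_pdivlMr ?powR_gt0// mulrC ler_pdivrMr ?powR_gt0//.
apply: (@le_trans _ _ ((c * (1 - t `^ q)) `^ p^-1)).
  by apply: ge0_ler_powR => //; rewrite ?nnegrE ?invr_ge0 ltW// mulr_gt0.
rewrite powRM ?(ltW c0) ?(ltW w1)// ler_wpM2r ?powR_ge0//.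
by apply: ler1_powR => //; rewrite invf_le1.
Qed.

End inequalities.

(** * Integrability of the integrand *)

Section integrability.
Variable R : realType.
Implicit Types (p q x y t c u : R).

Local Notation mu := (@lebesgue_measure R).

Lemma measurable_integrand p q : measurable_fun setT (integrand p q).
Proof.
apply: (measurableT_comp (measurable_powR _)).
by apply: measurable_funB => //; exact: measurable_powR.
Qed.

Lemma is_derive_powR_onem c x : x < 1 ->
  is_derive x 1 (fun t : R => (1 - t) `^ c) (- (c * (1 - x) `^ (c - 1))).
Proof.
move=> x1.
have d1 : is_derive x 1 (fun t : R => 1 - t) (0 - 1) by exact: is_deriveB.
have d2 : is_derive (1 - x) 1 (@powR R ^~ c) (c * (1 - x) `^ (c - 1)).
  by apply: is_derive1_powR; rewrite subr_gt0.
apply: (is_derive_eq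
  (@is_derive1_comp R (@powR R ^~ c) (fun t => 1 - t) x _ _ d2 d1)).
by rewrite sub0r mulrN1.
Qed.

Lemma is_derive_continuous (f : R -> R) x d : is_derive x 1 f d ->
  {for x, continuous f}.
Proof.
by move=> fx; apply: differentiable_continuous; apply/derivable1_diffP.
Qed.

Lemma continuous_integrand p q t : 0 < q -> 0 < t < 1 ->
  {for t, continuous (integrand p q)}.
Proof.
move=> q0 /andP[t0 t1].
have w1 : t `^ q < 1 by apply: powR_lt1 => //; exact: ltW.
apply: (@continuous_comp _ _ _ (@powR R ^~ q) (fun x : R => (1 - x) `^ (- p^-1))).
  exact: (is_derive_continuous (is_derive1_powR q t0)).
exact: (is_derive_continuous (is_derive_powR_onem _ w1)).
Qed.

(** Both sides vanish at [t = 1], by the convention [0 `^ r = 0]. *)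
Lemma integrand_le p q t : 1 < p -> 1 <= q -> 0 <= t <= 1 ->
  integrand p q t <= (1 - t) `^ (- p^-1).
Proof.
move=> p1 q1 /andP[t0]; have p0 : 0 < p by exact: lt_trans p1.
rewrite le_eqVlt => /predU1P[->|t1]; first by rewrite /integrand powR1.
have w1 : t `^ q < 1 by apply: powR_lt1 => //; exact: lt_le_trans q1.
rewrite integrandE powRN lef_pV2 ?posrE ?powR_gt0 ?subr_gt0//.
apply: ge0_ler_powR;
  rewrite ?nnegrE ?invr_ge0 ?subr_ge0 ?(ltW p0) ?(ltW w1) ?(ltW t1)//.
rewrite lerD2l lerN2; move: t0; rewrite le_eqVlt => /predU1P[<-|t0].
  by rewrite powR0// gt_eqF// (lt_le_trans _ q1).
by apply: ge1r_powR => //; rewrite t0 ltW.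
Qed.

Lemma integral_powR_onem u c : 0 < u -> u < 1 -> 0 < c -> c < 1 ->
  (\int[mu]_(t in `[0%R, c]) ((1 - t)%R `^ (- u))%R%:E <= ((1 - u)^-1)%R%:E)%E.
Proof.
move=> u0 u1 c0 c1.
pose F t : R := (- (1 - u)^-1) * (1 - t) `^ (1 - u).
have dF t : t < 1 -> is_derive t 1 F ((1 - t) `^ (- u)).
  move=> t1.
  apply: (is_derive_eq
    (is_deriveZ (- (1 - u)^-1) (is_derive_powR_onem (1 - u) t1))).
  rewrite /GRing.scale/= [1 - u - 1]addrAC subrr add0r.
  by field; rewrite subr_eq0 gt_eqF.
rewrite (@continuous_FTC2 _ _ F)//.
- rewrite -EFinB lee_fin /F subr0 powR1 mulr1 !mulNr opprK addrC gerBl.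
  by rewrite mulr_ge0 ?powR_ge0// invr_ge0 subr_ge0 ltW.
- apply: derivable_within_continuous => t; rewrite in_itv/= => /andP[_ tc].
  exact: (@ex_derive _ _ _ _ _ _ _
    (is_derive_powR_onem (- u) (le_lt_trans tc c1))).
- split.
  + move=> t; rewrite in_itv/= => /andP[_ tc].
    exact: (@ex_derive _ _ _ _ _ _ _ (dF t (lt_trans tc c1))).
  + exact/cvg_at_right_filter/(is_derive_continuous (dF 0 ltr01)).
  + exact/cvg_at_left_filter/(is_derive_continuous (dF c c1)).
- move=> t; rewrite in_itv/= => /andP[_ tc].
  by rewrite derive1E (@derive_val _ _ _ _ _ _ _ (dF t (lt_trans tc c1))).
Qed.

(** The majorant [(1 - t)^(-1/p)] has integrals over [[0, c]], [c < 1], bounded by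
    [1 / (1 - 1/p)]; monotone convergence carries the bound to [[0, 1[]. *)
Lemma integrable_integrand p q : 1 < p -> 1 < q ->
  mu.-integrable `[0, 1] (EFin \o integrand p q).
Proof.
move=> p1 q1; have p0 : 0 < p by exact: lt_trans p1.
have u0 : 0 < p^-1 by rewrite invr_gt0.
have u1 : p^-1 < 1 by rewrite invf_lt1.
have mk (D : set R) : measurable_fun D (EFin \o integrand p q).
  apply/measurable_EFinP; apply: measurable_funS (measurable_integrand p q) => //.
have mka (D : set R) : measurable_fun D (fun t => `|(integrand p q t)%:E|%E).
  by apply: measurableT_comp => //; exact: mk.
apply/integrableP; split; first exact: mk.
pose F (n : nat) : set R := `[0, 1 - n.+2%:R^-1]%classic.
have c0 (n : nat) : 0 < 1 - (n.+2%:R^-1 : R).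
  by rewrite subr_gt0 invf_lt1// ltr1n.
have c1 (n : nat) : 1 - (n.+2%:R^-1 : R) < 1.
  by rewrite ltrBlDr ltrDl invr_gt0.
have FU : \bigcup_n F n = `[0, 1[%classic.
  apply/seteqP; split => t /=.
    move=> [n _]; rewrite /F/= !in_itv/= => /andP[-> tn].
    exact: le_lt_trans (c1 n).
  rewrite in_itv/= => /andP[t0 t1].
  have [n] := ltr_add_invr t1.
  move=> tn; exists n => //; rewrite /F/= in_itv/= t0/= lerBrDr.
  rewrite (le_trans _ (ltW tn))// lerD2l lef_pV2 ?posrE//.
  by rewrite ler_nat.
have E : (\int[mu]_(t in `[0%R, 1%R[) `|(integrand p q t)%:E| =
    \int[mu]_(t in `[0%R, 1%R]) `|(integrand p q t)%:E|)%E.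
  apply: integral_itv_bndo_bndc; exact: mka.
apply: (@le_lt_trans _ _
  (\int[mu]_(t in `[0%R, 1%R[) `|(integrand p q t)%:E|)%E).
  by rewrite E.
rewrite -FU.
have cvF : (\int[mu]_(t in F n) `|(integrand p q t)%:E| @[n --> \oo])%E -->
    (\int[mu]_(t in \bigcup_n F n) `|(integrand p q t)%:E|)%E.
  apply: ge0_nondecreasing_set_cvg_integral => //.
  - apply/nondecreasing_seqP => n; rewrite subsetEset.
    apply: subset_itvl; rewrite bnd_simp lerD2l lerN2 lef_pV2 ?posrE//.
    by rewrite ler_nat.
  - by move=> n; exact: measurable_itv.
  - by move=> n; exact: mka.
rewrite -(cvg_lim _ cvF)//.
apply: (@le_lt_trans _ _ ((1 - p^-1)^-1)%:E); last by rewrite ltry.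
apply: lime_le; first by apply/cvg_ex; eexists; exact: cvF.
apply: nearW => n.
apply: le_trans (integral_powR_onem u0 u1 (c0 n) (c1 n)).
apply: ge0_le_integral => //.
- exact: measurable_itv.
- exact: mka.
- apply/measurable_EFinP; apply: measurableT_comp (measurable_powR _) _.
  exact: measurable_funB.
- move=> t; rewrite /F/= in_itv/= => /andP[t0 tn].
  rewrite lee_fin ger0_norm ?powR_ge0// integrand_le ?(ltW q1)// t0/=.
  exact/ltW/(le_lt_trans tn).
Qed.

End integrability.

(** * Calculus of the generalized arcsine and sine *)

Section arcsin_sin.
Variable R : realType.
Implicit Types (p q x y t c u l m : R).

Lemma ge0_derive_le (f df : R -> R) (a b : R) : a <= b ->
  {within `[a, b], continuous f} ->
  (forall x, a < x < b -> is_derive x 1 f (df x)) ->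
  (forall x, a < x < b -> 0 <= df x) -> f a <= f b.
Proof.
move=> ab cf fdf df0.
apply: (@ger0_derive1_le_cc R f a b) => //.
- by move=> x; rewrite in_itv/= => /fdf h; exact: (@ex_derive _ _ _ _ _ _ _ h).
- move=> x; rewrite in_itv/= => xab.
  by rewrite derive1E (@derive_val _ _ _ _ _ _ _ (fdf _ xab)) df0.
- by rewrite in_itv/= lexx.
- by rewrite in_itv/= ab lexx.
Qed.

Lemma within_itv_continuous (f : R -> R) (a b : R) :
  (forall x, a <= x <= b -> {for x, continuous f}) ->
  {within `[a, b], continuous f}.
Proof.
by move=> cf; apply: continuous_subspace_itv => x; rewrite in_itv/=; exact: cf.
Qed.

Section fixed_pq.
Variables p q : R.
Hypotheses (p1 : 1 < p) (q1 : 1 < q).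

Let p0 : 0 < p. Proof. exact: lt_trans p1. Qed.
Let q0 : 0 < q. Proof. exact: lt_trans q1. Qed.

Lemma arcsin_pq0 : arcsin_pq p q 0 = 0.
Proof. by rewrite /arcsin_pq set_itv1 Rintegral_set1. Qed.

Lemma is_derive_arcsin_pq x : 0 < x < 1 ->
  is_derive x 1 (arcsin_pq p q) (integrand p q x).
Proof.
move=> x01; have /andP[x0 x1] := x01.
have [dA A'] := continuous_FTC1_closed x1 (integrable_integrand p1 q1) x0
  (@continuous_integrand R p q x q0 x01).
by split; [exact: dA|rewrite -derive1E; exact: A'].
Qed.

(** Continuity at 0 is two-sided, since the integral over an empty interval
    vanishes for [x < 0]. *)
Lemma continuous_arcsin_pq x : 0 <= x < 1 -> {for x, continuous (arcsin_pq p q)}.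
Proof.
move=> /andP[]; rewrite le_eqVlt => /predU1P[<- _|x0 x1].
  have : arcsin_pq p q x @[x --> (0 : R)] --> (0 : R).
    exact: parameterized_integral_cvg_left ltr01 (integrable_integrand p1 q1).
  by rewrite -[X in _ --> X]arcsin_pq0.
by apply: is_derive_continuous; apply: is_derive_arcsin_pq; rewrite x0.
Qed.

Lemma within_continuous_arcsin_pq : {within `[0, 1], continuous (arcsin_pq p q)}.
Proof.
exact: parameterized_integral_continuous ler01 (integrable_integrand p1 q1).
Qed.

Lemma integrand_gt1 t : 0 < t < 1 -> 1 < integrand p q t.
Proof.
move=> /andP[t0 t1]; have w1 := powR_lt1 q0 (ltW t0) t1.
rewrite integrandE invf_gt1 ?powR_gt0 ?subr_gt0//.
apply: powR_lt1; rewrite ?invr_gt0 ?subr_ge0 ?(ltW w1)//.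
by rewrite ltrBlDr ltrDl powR_gt0.
Qed.

(** Mean value theorem, as the integrand exceeds 1. This gives at once strict
    monotonicity and the value larger than 1 at the point 1. *)
Lemma arcsin_pq_expanding x y : 0 <= x -> x < y -> y <= 1 ->
  y - x < arcsin_pq p q y - arcsin_pq p q x.
Proof.
move=> x0 xy y1.
have [||c] := @MVT R (arcsin_pq p q) (integrand p q) x y xy.
- move=> t; rewrite in_itv/= => /andP[xt ty].
  by apply: is_derive_arcsin_pq; rewrite (le_lt_trans x0 xt) (lt_le_trans ty).
- apply: continuous_subspaceW within_continuous_arcsin_pq.
  by apply: subset_itv; rewrite bnd_simp.
rewrite in_itv/= => /andP[xc cy] ->.
rewrite ltr_pMl ?subr_gt0//.
by apply: integrand_gt1; rewrite (le_lt_trans x0 xc) (lt_le_trans cy).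
Qed.

Lemma arcsin_pq_lt x y : 0 <= x -> x < y -> y <= 1 ->
  arcsin_pq p q x < arcsin_pq p q y.
Proof.
move=> x0 xy y1; rewrite -subr_gt0.
by apply: lt_trans (arcsin_pq_expanding x0 xy y1); rewrite subr_gt0.
Qed.

Lemma arcsin_pq_le_inv x y : 0 <= y -> x <= 1 ->
  arcsin_pq p q x <= arcsin_pq p q y -> x <= y.
Proof.
by move=> y0 x1; apply: contraLR; rewrite -!ltNge => yx; exact: arcsin_pq_lt.
Qed.

Lemma arcsin_pq_inj x y : 0 <= x <= 1 -> 0 <= y <= 1 ->
  arcsin_pq p q x = arcsin_pq p q y -> x = y.
Proof.
move=> /andP[x0 x1] /andP[y0 y1] xy; apply: le_anti.
by apply/andP; split; apply: arcsin_pq_le_inv => //; rewrite xy.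
Qed.

Lemma arcsin_pq1_gt1 : 1 < arcsin_pq p q 1.
Proof.
have := @arcsin_pq_expanding 0 1 (lexx _) ltr01 (lexx _).
by rewrite arcsin_pq0 !subr0.
Qed.

(** The intermediate value theorem makes the set of preimages of [y] nonempty,
    so the chosen value is one of them; it is not 1, where the arcsine exceeds
    [y]. *)
Lemma sin_pq_spec y : 0 <= y <= 1 ->
  0 <= sin_pq p q y < 1 /\ arcsin_pq p q (sin_pq p q y) = y.
Proof.
move=> /andP[y0 y1].
have [x x01 xy] : exists2 x, x \in `[0, 1] & arcsin_pq p q x = y.
  apply: IVT within_continuous_arcsin_pq _ => //.
  rewrite arcsin_pq0 ge_min le_max y0/=.
  by rewrite (le_trans y1 (ltW arcsin_pq1_gt1)) orbT.
have [/andP[s0 s1] sy] : [set x | 0 <= x <= 1 /\ arcsin_pq p q x = y]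
    (sin_pq p q y).
  by apply: (@getPex _ [set x | 0 <= x <= 1 /\ arcsin_pq p q x = y]); exists x.
split => //; rewrite s0/= lt_neqAle s1 andbT.
apply/eqP => s1E; move: y1; rewrite -sy s1E leNgt.
by rewrite arcsin_pq1_gt1.
Qed.

Lemma sin_pq_ge0 y : 0 <= y <= 1 -> 0 <= sin_pq p q y.
Proof. by move=> /sin_pq_spec[/andP[]]. Qed.

Lemma sin_pq_lt1 y : 0 <= y <= 1 -> sin_pq p q y < 1.
Proof. by move=> /sin_pq_spec[/andP[]]. Qed.

Lemma sin_pqK y : 0 <= y <= 1 -> arcsin_pq p q (sin_pq p q y) = y.
Proof. by move=> /sin_pq_spec[]. Qed.

Lemma arcsin_pqK x : 0 <= x <= 1 -> arcsin_pq p q x <= 1 ->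
  sin_pq p q (arcsin_pq p q x) = x.
Proof.
move=> x01 A1; have /andP[x0 x1] := x01.
have A01 : 0 <= arcsin_pq p q x <= 1.
  rewrite A1 andbT -arcsin_pq0; move: x0; rewrite le_eqVlt => /predU1P[->//|x0].
  by rewrite ltW// arcsin_pq_lt.
apply: arcsin_pq_inj => //; last exact: sin_pqK.
by rewrite sin_pq_ge0// ltW// sin_pq_lt1.
Qed.

Lemma le_sin_pq x y : 0 <= y <= 1 -> x <= 1 -> arcsin_pq p q x <= y ->
  x <= sin_pq p q y.
Proof.
move=> y01 x1 Axy; apply: arcsin_pq_le_inv; rewrite ?sin_pqK//.
exact: sin_pq_ge0.
Qed.

Lemma sin_pq_le x y : 0 <= y <= 1 -> 0 <= x -> y <= arcsin_pq p q x ->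
  sin_pq p q y <= x.
Proof.
move=> y01 x0 Axy; apply: arcsin_pq_le_inv; rewrite ?sin_pqK//.
by rewrite ltW// sin_pq_lt1.
Qed.

Lemma sin_pq_gt0 y : 0 < y <= 1 -> 0 < sin_pq p q y.
Proof.
move=> /andP[y0 y1]; have y01 : 0 <= y <= 1 by rewrite ltW.
rewrite lt_neqAle sin_pq_ge0// andbT; apply/eqP => s0.
by move: (sin_pqK y01); rewrite -s0 arcsin_pq0 => /eqP; rewrite lt_eqF.
Qed.

Lemma sin_pq0 : sin_pq p q 0 = 0.
Proof. by rewrite -[in LHS]arcsin_pq0 arcsin_pqK ?lexx ?ler01// arcsin_pq0. Qed.

Lemma arcsin_pq_le1 x y : 0 <= y <= 1 -> 0 <= x <= sin_pq p q y ->
  arcsin_pq p q x <= 1.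
Proof.
move=> y01 /andP[x0]; have /andP[_ y1] := y01.
rewrite le_eqVlt => /predU1P[->|xs]; first by rewrite sin_pqK.
rewrite (le_trans _ y1)// -[leRHS]sin_pqK// ltW// arcsin_pq_lt//.
by rewrite ltW// sin_pq_lt1.
Qed.

Lemma within_continuous_sin_pq y : 0 <= y <= 1 ->
  {within `[0, y], continuous (sin_pq p q)}.
Proof.
move=> y01.
suff : {within `[arcsin_pq p q 0, arcsin_pq p q (sin_pq p q y)],
    continuous (sin_pq p q)} by rewrite arcsin_pq0 sin_pqK.
have s1 : sin_pq p q y <= 1 by rewrite ltW// sin_pq_lt1.
apply: segment_can_le_continuous.
- exact: sin_pq_ge0.
- apply: continuous_subspaceW within_continuous_arcsin_pq.
  by apply: subset_itv; rewrite bnd_simp.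
- move=> x; rewrite in_itv/= => /andP[x0 xs].
  rewrite arcsin_pqK ?x0 ?(le_trans xs s1)//.
  by apply: (arcsin_pq_le1 y01); rewrite x0.
Qed.

Lemma is_derive_sin_pq y : 0 < y < 1 ->
  is_derive y 1 (sin_pq p q) (integrand p q (sin_pq p q y))^-1.
Proof.
move=> /andP[y0 y1].
have y01 : 0 <= y <= 1 by rewrite !ltW.
have i01 : 0 <= (1 : R) <= 1 by rewrite ler01 lexx.
have s0 : 0 < sin_pq p q y by apply: sin_pq_gt0; rewrite y0 ltW.
have s1 : sin_pq p q y < sin_pq p q 1.
  rewrite ltNge; apply/negP; rewrite le_eqVlt => /predU1P[e|lt].
    by move: y1; rewrite -[ltLHS]sin_pqK// -e sin_pqK// ltxx.
  have := arcsin_pq_lt (sin_pq_ge0 i01) lt (ltW (sin_pq_lt1 y01)).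
  by rewrite !sin_pqK// ltNge ltW.
suff : is_derive (arcsin_pq p q (sin_pq p q y)) 1 (sin_pq p q)
    (integrand p q (sin_pq p q y))^-1 by rewrite sin_pqK.
apply: is_derive_inverse.
- near=> x; have x0 : 0 < x by near: x; exact: lt_nbhsr.
  have x1 : x < sin_pq p q 1 by near: x; exact: lt_nbhsl.
  apply: arcsin_pqK.
    by rewrite (ltW x0)/= ltW// (lt_trans x1)// sin_pq_lt1.
  by apply: (arcsin_pq_le1 i01); rewrite !ltW.
- near=> x; have x0 : 0 < x by near: x; exact: lt_nbhsr.
  have x1 : x < sin_pq p q 1 by near: x; exact: lt_nbhsl.
  by apply: continuous_arcsin_pq; rewrite (ltW x0) (lt_trans x1)// sin_pq_lt1.
- by apply: is_derive_arcsin_pq; rewrite s0 sin_pq_lt1.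
- by rewrite gt_eqF// (lt_trans ltr01)// integrand_gt1// s0 sin_pq_lt1.
Unshelve. all: by end_near. Qed.

End fixed_pq.

End arcsin_sin.

(** * Concavity in the parameters *)

Section concavity.
Variable R : realType.
Implicit Types (p q x y t c u l m s : R).

Lemma is_derive_arcsin_pq_scale p q c s : 1 < p -> 1 < q -> 0 < c * s < 1 ->
  is_derive s 1 (fun t => arcsin_pq p q (c * t)) (c * integrand p q (c * s)).
Proof.
move=> p1 q1 cs01.
have d1 : is_derive s 1 (fun t : R => c * t) (c * 1).
  exact: (is_deriveZ c (is_derive_id s 1)).
have dA := is_derive_arcsin_pq p1 q1 cs01.
apply: (is_derive_eq
  (@is_derive1_comp R (arcsin_pq p q) (fun t => c * t) s _ _ dA d1)).
by rewrite mulr1 mulrC.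
Qed.

Lemma continuous_arcsin_pq_scale p q c s : 1 < p -> 1 < q -> 0 <= c * s < 1 ->
  {for s, continuous (fun t => arcsin_pq p q (c * t))}.
Proof.
move=> p1 q1 cs01.
apply: (@continuous_comp _ _ _ (fun t : R => c * t) (arcsin_pq p q)).
  exact: mulrl_continuous.
exact: continuous_arcsin_pq.
Qed.

(** With [x1], [x2] the two sines and [x] their combination, the difference
    [D s = l A1 (x1 s) + m A2 (x2 s) - A (x s)] is nondecreasing in [s]: up to the
    factor [s], its derivative is the convexity defect of [z k_(p,q)(z)] at the
    points [x1 s], [x2 s]. At [s = 1] its nonnegativity reads [A x <= y]. *)
Lemma sin_pq_concave_p y q p1 p2 l m : 0 <= y <= 1 -> 1 < q ->
  1 < p1 -> 1 < p2 -> 0 <= l -> 0 <= m -> l + m = 1 ->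
  l * sin_pq p1 q y + m * sin_pq p2 q y <= sin_pq (l * p1 + m * p2) q y.
Proof.
move=> y01 q1 p11 p21 l0 m0 lm.
set p := l * p1 + m * p2; have p_gt1 : 1 < p by exact: comb_gt.
have /andP[] := y01; rewrite le_eqVlt => /predU1P[<- _|y0 y1].
  by rewrite !sin_pq0// !mulr0 addr0.
have S01 r : 1 < r -> 0 < sin_pq r q y < 1.
  by move=> r1; rewrite sin_pq_lt1// andbT sin_pq_gt0// y0.
have x1P := S01 _ p11; have x2P := S01 _ p21.
have A1 := sin_pqK p11 q1 y01; have A2 := sin_pqK p21 q1 y01.
move: x1P x2P A1 A2; move: (sin_pq p1 q y) (sin_pq p2 q y) => x1 x2.
move=> /andP[x10 x11] /andP[x20 x21] A1 A2.
set x := l * x1 + m * x2.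
have x0 : 0 < x by exact: comb_gt.
have x_lt1 : x < 1 by exact: comb_lt.
apply: le_sin_pq => //; first exact: ltW.
pose D s := l * arcsin_pq p1 q (x1 * s) + m * arcsin_pq p2 q (x2 * s)
  - arcsin_pq p q (x * s).
pose dD s := l * (x1 * integrand p1 q (x1 * s)) +
  m * (x2 * integrand p2 q (x2 * s)) - x * integrand p q (x * s).
have mul01 c s : 0 < c -> c < 1 -> 0 <= s <= 1 -> 0 <= c * s < 1.
  move=> c0 c1 /andP[s0 s1]; rewrite mulr_ge0 ?(ltW c0)//=.
  by rewrite (le_lt_trans _ c1)// ger_pMr.
have mul01' c s : 0 < c -> c < 1 -> 0 < s < 1 -> 0 < c * s < 1.
  move=> c0 c1 /andP[s0 s1]; rewrite mulr_gt0//=.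
  by rewrite (lt_trans _ c1)// gtr_pMr.
suff : D 0 <= D 1.
  rewrite /D !mulr0 !mulr1 !arcsin_pq0// A1 A2 !mulr0 addr0 subr0.
  by rewrite -mulrDl lm mul1r subr_ge0.
apply: (@ge0_derive_le R D dD) => //.
- apply: within_itv_continuous => s s01.
  apply: continuousB; last first.
    by apply: continuous_arcsin_pq_scale => //; exact: mul01.
  apply: continuousD; apply: continuousM; try exact: cst_continuous;
    by apply: continuous_arcsin_pq_scale => //; exact: mul01.
- move=> s s01.
  have d1 := is_derive_arcsin_pq_scale p11 q1 (mul01' _ _ x10 x11 s01).
  have d2 := is_derive_arcsin_pq_scale p21 q1 (mul01' _ _ x20 x21 s01).
  have d := is_derive_arcsin_pq_scale p_gt1 q1 (mul01' _ _ x0 x_lt1 s01).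
  exact: (is_deriveB (is_deriveD (is_deriveZ l d1) (is_deriveZ m d2)) d).
- move=> s s01; have /andP[s0 s1] := s01.
  have s01' : 0 <= s <= 1 by rewrite !ltW.
  have := mul_powR_integrand_convex (ltW q1) l0 m0 lm (mul01 _ _ x10 x11 s01')
    (mul01 _ _ x20 x21 s01') (lt_trans ltr01 p11) (lt_trans ltr01 p21).
  rewrite -/p /dD.
  move: (integrand p1 q _) (integrand p2 q _) => k1 k2.
  rewrite !mulrA -mulrDl -/x; move: (integrand p q _) => k h.
  rewrite -(pmulr_rge0 _ s0) mulrBr subr_ge0.
  rewrite (_ : s * (x * k) = x * s * k); last by ring.
  by rewrite (_ : s * (l * x1 * k1 + m * x2 * k2) =
    l * x1 * s * k1 + m * x2 * s * k2); last by ring.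
Qed.

Lemma sin_pq_nondecreasing_q p q1 q2 y : 0 <= y <= 1 -> 1 < p -> 1 < q1 ->
  q1 <= q2 -> sin_pq p q1 y <= sin_pq p q2 y.
Proof.
move=> y01 p1 q11 q12; have q21 : 1 < q2 by exact: lt_le_trans q12.
have S0 := sin_pq_ge0 p1 q11 y01; have S1 := sin_pq_lt1 p1 q11 y01.
have A1 := sin_pqK p1 q11 y01.
apply: le_sin_pq => //; first exact: ltW.
rewrite -[leRHS]A1 -subr_ge0; move: S0 S1 {A1}.
move: (sin_pq p q1 y) => x x0 x1.
pose D s := arcsin_pq p q1 s - arcsin_pq p q2 s.
suff : D 0 <= D x by rewrite /D !arcsin_pq0// subrr.
apply: (@ge0_derive_le R D (fun s => integrand p q1 s - integrand p q2 s)) => //.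
- apply: within_itv_continuous => s /andP[s0 sx].
  have s01 : 0 <= s < 1 by rewrite s0 (le_lt_trans sx).
  by apply: continuousB; exact: continuous_arcsin_pq.
- move=> s /andP[s0 sx]; have s01 : 0 < s < 1 by rewrite s0 (lt_trans sx).
  exact: (is_deriveB (is_derive_arcsin_pq p1 q11 s01)
                     (is_derive_arcsin_pq p1 q21 s01)).
- move=> s /andP[s0 sx]; rewrite subr_ge0 integrand_le_exponent//.
  + exact: lt_trans p1.
  + exact: lt_trans q11.
  + by rewrite s0 (lt_trans sx).
Qed.

(** Put [q2 = c q1]. By [integrand_scale_exponent], the arcsine for [q2] at [c x]
    dominates the one for [q1] at [x], so [S2 y <= c S1 y]; when [c S1 y >= 1]
    this is clear from [S2 y < 1]. *)
Lemma sin_pq_div_nonincreasing_q p q1 q2 y : 0 <= y <= 1 -> 1 < p -> 1 < q1 ->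
  q1 <= q2 -> sin_pq p q2 y * q1 <= sin_pq p q1 y * q2.
Proof.
move=> y01 p1 q11 q12; have q21 : 1 < q2 by exact: lt_le_trans q12.
have q10 : 0 < q1 by exact: lt_trans q11.
have S0 := sin_pq_ge0 p1 q11 y01; have A1 := sin_pqK p1 q11 y01.
have [c [c1 q2E]] : exists c, 1 <= c /\ q2 = c * q1.
  exists (q2 / q1); split; first by rewrite ler_pdivlMr// mul1r.
  by rewrite divfK// gt_eqF.
have c0 : 0 < c by exact: lt_le_trans c1.
suff le_scale : sin_pq p q2 y <= c * sin_pq p q1 y.
  apply: (le_trans (ler_wpM2r (ltW q10) le_scale)).
  by rewrite mulrAC -q2E mulrC.
have [cx1|cx1] := leP 1 (c * sin_pq p q1 y).
  by apply: le_trans cx1; rewrite ltW// sin_pq_lt1.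
apply: sin_pq_le => //; first by rewrite mulr_ge0// ltW.
rewrite -[leLHS]A1 -subr_ge0; move: S0 cx1 {A1}.
move: (sin_pq p q1 y) => x x0 x1.
pose D s := arcsin_pq p q2 (c * s) - arcsin_pq p q1 s.
have scale01 s : s < x -> c * s < 1.
  by move=> sx; apply: le_lt_trans x1; rewrite ler_pM2l// ltW.
have le_scaled s : 0 <= s -> s <= c * s by move=> s0; rewrite ler_peMl.
suff : D 0 <= D x by rewrite /D mulr0 !arcsin_pq0// subrr.
apply: (@ge0_derive_le R D
  (fun s => c * integrand p q2 (c * s) - integrand p q1 s)) => //.
- apply: within_itv_continuous => s /andP[s0 sx].
  have cs1 : c * s < 1 by apply: le_lt_trans x1; rewrite ler_pM2l.
  apply: continuousB.
    by apply: continuous_arcsin_pq_scale => //; rewrite cs1 mulr_ge0// ltW.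
  by apply: continuous_arcsin_pq => //; rewrite s0 (le_lt_trans (le_scaled _ s0)).
- move=> s /andP[s0 sx]; have cs1 := scale01 _ sx.
  have cs01 : 0 < c * s < 1 by rewrite cs1 mulr_gt0.
  have s01 : 0 < s < 1 by rewrite s0 (le_lt_trans (le_scaled _ (ltW s0))).
  exact: (is_deriveB (is_derive_arcsin_pq_scale p1 q21 cs01)
                     (is_derive_arcsin_pq p1 q11 s01)).
- move=> s /andP[s0 sx]; rewrite subr_ge0 q2E.
  by apply: integrand_scale_exponent; rewrite ?(ltW p1)// scale01.
Qed.

(** The combination [W] of the two sines satisfies [k_(p,q)(W) W' <= 1]: at each
    time the two sines are endpoints of a segment to which
    [integrand_inv_segment_concave] applies. Integrating,
    [A_(p,q)(W y) <= y]. *)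
Lemma sin_pq_concave_q_le y p q1 q2 l m : 0 <= y <= 1 -> 1 < p ->
  1 < q1 -> q1 <= q2 -> 0 <= l -> 0 <= m -> l + m = 1 ->
  l * sin_pq p q1 y + m * sin_pq p q2 y <= sin_pq p (l * q1 + m * q2) y.
Proof.
move=> y01 p1 q11 q12 l0 m0 lm.
have q21 : 1 < q2 by exact: lt_le_trans q12.
set q := l * q1 + m * q2; have q_gt1 : 1 < q by exact: comb_gt.
have /andP[y0 y1] := y01.
pose W s := l * sin_pq p q1 s + m * sin_pq p q2 s.
have W01 s : 0 <= s <= 1 -> 0 <= W s < 1.
  move=> s01; apply/andP; split.
    by rewrite addr_ge0// mulr_ge0// sin_pq_ge0.
  by apply: comb_lt => //; exact: sin_pq_lt1.
have W0 : W 0 = 0 by rewrite /W !sin_pq0// !mulr0 addr0.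
have /andP[Wy0 Wy1] := W01 _ y01.
rewrite -/(W y); apply: le_sin_pq => //; first exact: ltW.
pose V s := s - arcsin_pq p q (W s).
pose dW s := l * (integrand p q1 (sin_pq p q1 s))^-1 +
             m * (integrand p q2 (sin_pq p q2 s))^-1.
suff : V 0 <= V y by rewrite /V W0 arcsin_pq0// subrr subr_ge0.
apply: (@ge0_derive_le R V (fun s => 1 - integrand p q (W s) * dW s)) => //.
- have cZ c r : 1 < r ->
      {within `[0, y], continuous (fun s => c * sin_pq p r s)}.
    move=> r1; apply: (@within_continuous_comp _ _ _ _ _ ( *%R c)).
      by move=> x _; exact: mulrl_continuous.
    exact: within_continuous_sin_pq.
  have cW : {within `[0, y], continuous W}.
    exact: within_continuousD (cZ l _ q11) (cZ m _ q21).
  have cAW : {within `[0, y], continuous (arcsin_pq p q \o W)}.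
    apply: within_continuous_comp cW => x.
    rewrite inE => -[s]; rewrite /= in_itv/= => /andP[s0 sy] <-.
    by apply: continuous_arcsin_pq => //; apply: W01; rewrite s0 (le_trans sy).
  have cid : {within `[0, y], continuous (id : R -> R)}.
    by apply: within_itv_continuous => s _; exact: cvg_id.
  exact: within_continuousB cid cAW.
- move=> s /andP[s0 sy]; have s01 : 0 < s < 1 by rewrite s0 (lt_le_trans sy).
  have s01' : 0 <= s <= 1 by have /andP[_ /ltW->] := s01; rewrite ltW.
  have s01'' : 0 < s <= 1 by rewrite s0; case/andP: s01'.
  have dWs : is_derive s 1 W (dW s).
    exact: (is_deriveD (is_deriveZ l (is_derive_sin_pq p1 q11 s01))
                       (is_deriveZ m (is_derive_sin_pq p1 q21 s01))).
  have Ws01 : 0 < W s < 1.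
    have /andP[_ ->] := W01 _ s01'; rewrite andbT.
    by apply: comb_gt => //; exact: sin_pq_gt0.
  exact: (is_deriveB (is_derive_id s 1)
    (@is_derive1_comp R (arcsin_pq p q) W s _ _
      (is_derive_arcsin_pq p1 q_gt1 Ws01) dWs)).
- move=> s /andP[s0 sy].
  have s1 : s <= 1 by rewrite (le_trans (ltW sy)).
  have s01 : 0 <= s <= 1 by rewrite s1 ltW.
  rewrite subr_ge0 mulrC -ler_pdivlMr ?div1r; last first.
    by apply: integrand_gt0; [exact: lt_trans q_gt1|exact: W01].
  have s01' : 0 < s <= 1 by rewrite s0.
  exact: (integrand_inv_segment_concave p1 l0 m0 lm (lt_trans ltr01 q11) q12
    (sin_pq_gt0 p1 q11 s01') (sin_pq_nondecreasing_q s01 p1 q11 q12)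
    (sin_pq_lt1 p1 q21 s01) (sin_pq_div_nonincreasing_q s01 p1 q11 q12)).
Qed.

Lemma sin_pq_concave_q y p q1 q2 l m : 0 <= y <= 1 -> 1 < p ->
  1 < q1 -> 1 < q2 -> 0 <= l -> 0 <= m -> l + m = 1 ->
  l * sin_pq p q1 y + m * sin_pq p q2 y <= sin_pq p (l * q1 + m * q2) y.
Proof.
move=> y01 p1 q11 q21 l0 m0 lm; have [q12|/ltW q12] := leP q1 q2.
  exact: sin_pq_concave_q_le.
rewrite addrC [l * q1 + _]addrC; apply: sin_pq_concave_q_le => //.
by rewrite addrC.
Qed.

End concavity.

Theorem theorem3 (R : realType) :
  (forall y q : R, 0 <= y <= 1 -> 1 < q ->
    concave_function (`]1, +oo[%classic : set R^o)
      (fun p : R => sin_pq p q y)) /\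
  (forall y p : R, 0 <= y <= 1 -> 1 < p ->
    concave_function (`]1, +oo[%classic : set R^o)
      (fun q : R => sin_pq p q y)).
Proof.
split=> y r y01 r1 t a b; rewrite !inE/= !in_itv/= !andbT => a1 b1.
- rewrite !convRE; apply: sin_pq_concave_p => //; first by rewrite subr_ge0.
  by rewrite addrC subrK.
- rewrite !convRE; apply: sin_pq_concave_q => //; first by rewrite subr_ge0.
  by rewrite addrC subrK.
Qed.
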